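(* Let $(X,H)$ be a hypergraph with at most continuum many connected components, each of which is countable. Then the poset $P(X,H)$ is $\sigma$-centred, i.e. $P(X,H)$ is a union of countably many centred subsets.
   Context: A hypergraph is a pair $(X,H)$ where $X$ is a set and $H$ (the set of edges) is a collection of finite subsets of $X$ of size at least $2$. Its connected components are the classes of the equivalence relation on $X$ generated by declaring $x\sim y$ whenever $x,y$ lie in a common edge. A subset $A\subseteq X$ is an anti-clique if no subset of $A$ belongs to $H$. $P(X,H)$ denotes the poset of all finite anti-cliques of $(X,H)$ ordered by reverse inclusion ($p\le q$ iff $p\supseteq q$). A subset $A$ of a poset is centred if every finite subset of $A$ has a common lower bound in the poset. *)

(* Defs.v *)
From HB Require Import structures.
From mathcomp Require Import all_boot all_order.
From mathcomp Require Import boolp classical_sets functions cardinality.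
From Stdlib Require Import Relation_Operators.

Set Implicit Arguments.
Unset Strict Implicit.
Unset Printing Implicit Defensive.

Local Open Scope classical_set_scope.
Local Open Scope order_scope.
Local Open Scope card_scope.

Record hypergraph (X : Type) := Hypergraph {
  edges : set (set X);
  edge_finite : forall e, edges e -> finite_set e;
  edge_card_ge2 : forall e, edges e -> `I_2 #<= e }.

Section Components.
Variables (X : Type) (G : hypergraph X).

Definition adjacent (x y : X) : Prop :=
  exists2 e, edges G e & e x /\ e y.

Definition connected_to : X -> X -> Prop := clos_refl_sym_trans X adjacent.

Definition components : set (set X) := range (fun x => [set y | connected_to x y]).

End Components.

Section Anticliques.
Variables (X : Type) (G : hypergraph X).

Definition anticlique (A : set X) : Prop :=
  forall e, e `<=` A -> ~ edges G e.

Definition anticlique_poset : Type :=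
  set_type [set p : set X | finite_set p /\ anticlique p].

HB.instance Definition _ := Choice.on anticlique_poset.

(* Reverse inclusion. *)
Definition anticlique_le (p q : anticlique_poset) : bool :=
  `[< set_val q `<=` set_val p >].

Lemma anticlique_le_refl : reflexive anticlique_le.
Proof. by move=> p; apply/asboolP. Qed.

Lemma anticlique_le_anti : antisymmetric anticlique_le.
Proof.
move=> p q /andP[/asboolP qp /asboolP pq].
by apply: val_inj; apply/seteqP; split.
Qed.

Lemma anticlique_le_trans : transitive anticlique_le.
Proof.
move=> q p r /asboolP qp /asboolP rq; apply/asboolP.
exact: subset_trans rq qp.
Qed.

Fact anticlique_display : Order.disp_t. Proof. exact: Order.Disp tt tt. Qed.

HB.instance Definition _ := Order.Le_isPOrder.Build anticlique_display
  anticlique_poset anticlique_le_refl anticlique_le_anti anticlique_le_trans.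

End Anticliques.

Section Centred.
Variables (d : Order.disp_t) (P : porderType d).

Definition centred (A : set P) : Prop :=
  forall F : set P, F `<=` A -> finite_set F ->
    exists l : P, forall p, F p -> l <= p.

Definition sigma_centred : Prop :=
  exists C : set (set P),
    [/\ countable C, forall A, C A -> centred A & \bigcup_(A in C) A = [set: P]].

End Centred.

Arguments sigma_centred {d} P.

(* Main.v *)
(** Choose [c x], a real coding the component of [x], and [e x], a natural
    number numbering [x] inside its component.  Colour a finite anti-clique [p]
    by a length [N] such that the [N]-bit prefixes separate the reals [c x],
    [x] in [p], together with the finite set of all pairs (prefix of [c x],
    [e x]).  An edge lies in one component, so if it is covered by anti-cliques
    of the same colour, then any one of them that meets the edge contains it;
    hence same-coloured anti-cliques have anti-clique finite unions. *)
Require Import Defs.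
From mathcomp Require Import all_boot all_order.
From mathcomp Require Import boolp classical_sets functions cardinality.
From Stdlib Require Import Relation_Operators.
Local Open Scope classical_set_scope.
Local Open Scope card_scope.

Definition prefix_bits (N : nat) (A : set nat) : seq bool :=
  mkseq (fun n => `[< A n >]) N.

Lemma prefix_bitsP (N : nat) (A B : set nat) :
  prefix_bits N A = prefix_bits N B -> forall n, (n < N)%N -> A n = B n.
Proof.
move=> AB n nN; apply/propext; apply: asbool_eq_equiv.
have := congr1 (fun s => nth false s n) AB.
by rewrite !nth_mkseq.
Qed.

(** Distinct sets differ at some index; finitely many pairs call for finitely many such indices, and
    [N] exceeds them all. *)
Lemma finite_set_prefix_bits_inj (S : set (set nat)) :
  finite_set S -> exists N, set_inj S (prefix_bits N).
Proof.
move=> Sfin.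
have /choice[d dP] (AB : set nat * set nat) :
    exists n, AB.1 n = AB.2 n -> AB.1 = AB.2.
  have [->|AB12] := pselect (AB.1 = AB.2); first by exists 0%N.
  have /existsNP[n ABn] : ~ forall n, AB.1 n = AB.2 n.
    by move=> eqAB; apply: AB12; apply/funext.
  by exists n.
have [s sE] := (finite_seqP _).1 (finite_image d (finite_setX Sfin Sfin)).
exists (\max_(i <- s) i).+1 => A B; rewrite !inE => SA SB /prefix_bitsP AB.
apply: (dP (A, B)); apply: AB; rewrite ltnS.
have ds : d (A, B) \in s.
  by have : (d @` (S `*` S)) (d (A, B)) by [exists (A, B)]; rewrite sE.
exact: (@leq_bigmax_seq _ s xpredT id).
Qed.

Section Colouring.
Variables (X : Type) (G : hypergraph X) (c : X -> set nat) (e : X -> nat).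
Hypothesis edge_code : forall E x y, edges G E -> E x -> E y -> c x = c y.
Hypothesis code_inj : forall x y, c x = c y -> e x = e y -> x = y.

Definition trace (N : nat) (x : X) : seq bool * nat := (prefix_bits N (c x), e x).

(** The finite set of traces is given by a list so that the colours [k] range over a countable type;
    several lists may name the same class. *)
Definition colour_class (k : nat * seq (seq bool * nat)) : set (anticlique_poset G) :=
  [set p | set_inj (c @` set_val p) (prefix_bits k.1) /\
           trace k.1 @` set_val p = [set` k.2]].

Lemma colour_class_cover (p : anticlique_poset G) : exists k, colour_class k p.
Proof.
have [pfin _] := set_valP p.
have [N Ninj] := finite_set_prefix_bits_inj _ (finite_image c pfin).
have [s sE] := (finite_seqP _).1 (finite_image (trace N) pfin).
by exists (N, s).
Qed.

(** The shared colour supplies some [z] in [p] with the trace of [y]. As [c y = c x], the prefixes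
    of [c z] and [c x] agree, and separation inside [p] upgrades this to [c z = c x = c y]; equal
    numbers then force [z = y]. *)
Lemma colour_class_edge k (p q : anticlique_poset G) (E : set X) (x y : X) :
  colour_class k p -> colour_class k q -> edges G E -> E x -> E y ->
  set_val p x -> set_val q y -> set_val p y.
Proof.
move=> [pinj pk] [_ qk] GE Ex Ey px qy.
have [z pz [zy ezy]] : (trace k.1 @` set_val p) (trace k.1 y).
  by rewrite pk -qk; exists y.
have xy := edge_code _ _ _ GE Ex Ey.
have cz : c z = c x.
  by apply: pinj; rewrite ?inE; [exists z|exists x|rewrite zy xy].
by rewrite -(code_inj _ _ (etrans cz xy) ezy).
Qed.

Lemma colour_class_centred k : centred (colour_class k).
Proof.
move=> F Fk Ffin.
pose U := \bigcup_(p in F) set_val p.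
have Ufin : finite_set U.
  by apply: bigcup_finite => // p _; case: (set_valP p).
have Uac : anticlique G U.
  move=> E EU GE.
  (* A point of [E] is needed to select [p]; the size bound on edges excludes the empty set. *)
  have [x Ex] : E !=set0.
    apply/set0P/eqP => E0; have := edge_card_ge2 GE.
    rewrite E0 card_le0 => /eqP I0.
    by have : `I_2 0%N by []; rewrite I0.
  have [p Fp px] := EU x Ex.
  have [_ pac] := set_valP p.
  apply: (pac E _ GE) => y Ey.
  have [q Fq qy] := EU y Ey.
  exact: (colour_class_edge _ _ _ _ _ _ (Fk p Fp) (Fk q Fq) GE Ex Ey px qy).
exists (SigSub (mem_set (conj Ufin Uac)) : anticlique_poset G) => p Fp.
by apply/asboolP => x px; exists p.
Qed.

Lemma code_sigma_centred : sigma_centred (anticlique_poset G).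
Proof.
exists (range colour_class); split.
- exact: card_le_trans (card_image_le _ _) (countableP _).
- by move=> _ [k _ <-]; exact: colour_class_centred.
- apply/seteqP; split=> // p _.
  have [k kp] := colour_class_cover p.
  by exists (colour_class k) => //; exists k.
Qed.

End Colouring.

Theorem theorem4 (X : Type) (G : hypergraph X)
  (components_le_continuum : components G #<= [set: set nat])
  (components_countable : forall C : set X, components G C -> countable C) :
  sigma_centred (anticlique_poset G).
Proof.
have [f f_inj] := pcard_injP components_le_continuum.
have /choice[g g_inj] (C : set X) :
    exists h : X -> nat, components G C -> {in C &, injective h}.
  have [/components_countable/countable_injP[h hinj]|nC] := pselect (components G C).
    by exists h.
  (* Dummy numbering off the components, since [choice] asks for a function at every [C]. *)
  by exists (fun=> 0%N).
pose K x := [set y | connected_to G x y].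
have KG x : components G (K x) by exists x.
have Kx x : K x x by exact: rst_refl.
apply: (@code_sigma_centred X G (f \o K) (fun x => g (K x) x)).
- move=> E x y GE Ex Ey /=; congr (f _).
  have xy : connected_to G x y by apply: rst_step; exists E.
  apply/seteqP; split=> z; last exact: rst_trans.
  by apply: rst_trans; exact: rst_sym.
- move=> x y /= fxy.
  have Kxy : K x = K y by apply: f_inj; rewrite ?inE.
  (* Once the components coincide, both points are numbered by the same injection [g (K y)]. *)
  rewrite Kxy => /(g_inj _ (KG y)); apply; rewrite inE //.
  by rewrite -Kxy.
Qed.
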